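(* Let $\beta\in(0,1)$ and let $A(t)$, $\phi(t)$ be as defined in the context. Then, as $t\to0^+$, $$A(t)=\left(\frac32\right)^{\frac12}-\frac{1}{3\sqrt6}\left(\frac{1}{\Gamma(1+2\beta)}-\frac{1}{2\Gamma(1+\beta)^2}\right)t^{2\beta}+O(t^{4\beta}),$$ $$\phi(t)=\frac{t^\beta}{\Gamma(1+\beta)}+O(t^{3\beta}).$$ Here $\frac{1}{\Gamma(1+2\beta)}-\frac{1}{2\Gamma(1+\beta)^2}\ge0$ for $\beta\in(0,1]$, with equality if and only if $\beta=1$.
   Context: Define real numbers $c_n=c_n(\beta)$ by $c_0=1$ and, for $n\ge0$, $$c_{n+1}=(-1)^{\lfloor n/2\rfloor}\sum_{n_1+n_2+n_3=n}\frac{(-1)^{\lfloor n_1/2\rfloor+\lfloor n_2/2\rfloor+\lfloor n_3/2\rfloor}3^{-\sigma(n_1,n_2,n_3)}\Gamma(1+\beta n)c_{n_1}c_{n_2}c_{n_3}}{\Gamma(1+\beta n_1)\Gamma(1+\beta n_2)\Gamma(1+\beta n_3)},$$ the sum being over ordered triples of nonnegative integers, with $\sigma=0$ if $n_1,n_2,n_3$ are all even or all odd and $\sigma=1$ otherwise (so $c_0=c_1=c_2=1$). Set $$E_c(t)=\sum_{k=0}^\infty(-1)^k\frac{c_{2k}2^{-\frac12}3^{-(2k-\frac12)}t^{2\beta k}}{\Gamma(1+2\beta k)},\qquad E_s(t)=\sum_{k=0}^\infty(-1)^k\frac{c_{2k+1}2^{-\frac12}3^{-(2k+\frac12)}t^{\beta(2k+1)}}{\Gamma(1+\beta(2k+1))}$$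 for $t\in[0,T)$, where $T>0$ is such that both series converge there. The function $u(x,t)=E_c(t)\cos(x/3)+E_s(t)\sin(x/3)$ is the series solution, produced by the homotopy perturbation method, of the fractional $K(3,3)$ equation $\partial_t^\beta u+\partial_x(u^3)+\partial_x^3(u^3)=0$ (Caputo derivative in time) with initial datum $\left(\frac32\right)^{1/2}\cos(x/3)$. Define $$A(t)=\left(E_c(t)^2+E_s(t)^2\right)^{1/2},\qquad\tan\left(\frac{\phi(t)}{3}\right)=\frac{E_s(t)}{E_c(t)},$$ such that $u(x,t)=A(t)\cos\left(\frac{x-\phi(t)}{3}\right)$, with $\phi$ continuous, real-valued, and $\phi(0)=0$. *)

(* Defs.v *)
From HB Require Import structures.
From mathcomp Require Import all_boot all_order all_algebra.
From mathcomp Require Import all_classical all_reals all_analysis.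

Set Implicit Arguments.
Unset Strict Implicit.
Unset Printing Implicit Defensive.

Import Order.TTheory GRing.Theory Num.Theory.
Import numFieldNormedType.Exports.

Local Open Scope classical_set_scope.
Local Open Scope ring_scope.

(* Euler's integral; only used at arguments x >= 1, where it converges. *)
Definition Gamma (R : realType) (x : R) : R :=
  \int[lebesgue_measure]_(s in `]0, +oo[) (s `^ (x - 1) * expR (- s)).

Definition sigma (n1 n2 n3 : nat) : nat :=
  if (odd n1 == odd n2) && (odd n2 == odd n3) then 0%N else 1%N.

(* The right-hand side of the recurrence for c_(n+1), as a functional of the
   whole sequence c; it only reads c 0, ..., c n. *)
Definition c_rec (R : realType) (beta : R) (c : nat -> R) (n : nat) : R :=
  (-1) ^+ n./2 *
  \sum_(n1 < n.+1) \sum_(n2 < n.+1) \sum_(n3 < n.+1 | (n1 + n2 + n3 == n)%N)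
    ((-1) ^+ (n1./2 + n2./2 + n3./2)%N * 3 ^- sigma n1 n2 n3
       * Gamma (1 + beta * n%:R) * c n1 * c n2 * c n3)
    / (Gamma (1 + beta * n1%:R) * Gamma (1 + beta * n2%:R)
       * Gamma (1 + beta * n3%:R)).

(* The list [:: c_0; ...; c_n]. *)
Fixpoint c_seq (R : realType) (beta : R) (n : nat) : seq R :=
  if n is m.+1
  then rcons (c_seq beta m) (c_rec beta (nth 0 (c_seq beta m)) m)
  else [:: 1].

Definition c (R : realType) (beta : R) (n : nat) : R := nth 0 (c_seq beta n) n.

Lemma size_c_seq (R : realType) (beta : R) (n : nat) :
  size (c_seq beta n) = n.+1.
Proof. by elim: n => //= n IH; rewrite size_rcons IH. Qed.

Lemma nth_c_seq (R : realType) (beta : R) (n i : nat) :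
  (i <= n)%N -> nth 0 (c_seq beta n) i = c beta i.
Proof.
elim: n => [|n IH]; first by rewrite leqn0 => /eqP ->.
rewrite leq_eqVlt => /predU1P[->//|lt_in].
by rewrite /= nth_rcons size_c_seq lt_in IH.
Qed.

Lemma c0 (R : realType) (beta : R) : c beta 0%N = 1.
Proof. by []. Qed.

Lemma cS (R : realType) (beta : R) (n : nat) :
  c beta n.+1 = c_rec beta (c beta) n.
Proof.
rewrite {1}/c /= nth_rcons size_c_seq ltnn eqxx /c_rec; congr (_ * _).
apply: eq_bigr => n1 _; apply: eq_bigr => n2 _; apply: eq_bigr => n3 _.
by rewrite !nth_c_seq // -ltnS.
Qed.

(* At t = 0 the k = 0 term uses 0 `^ 0 = 1. *)
Definition Ec_term (R : realType) (beta t : R) (k : nat) : R :=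
  (-1) ^+ k *
  (c beta (2 * k)%N * 2 `^ (- (1 / 2)) * 3 `^ (- (2 * k%:R - 1 / 2))
     * t `^ (2 * beta * k%:R))
  / Gamma (1 + 2 * beta * k%:R).

Definition Es_term (R : realType) (beta t : R) (k : nat) : R :=
  (-1) ^+ k *
  (c beta (2 * k + 1)%N * 2 `^ (- (1 / 2)) * 3 `^ (- (2 * k%:R + 1 / 2))
     * t `^ (beta * (2 * k%:R + 1)))
  / Gamma (1 + beta * (2 * k%:R + 1)).

Definition Ec (R : realType) (beta t : R) : R := limn (series (Ec_term beta t)).

Definition Es (R : realType) (beta t : R) : R := limn (series (Es_term beta t)).

Definition series_converge_on (R : realType) (beta T : R) : Prop :=
  forall t : R, 0 <= t < T ->
    cvgn (series (Ec_term beta t)) /\ cvgn (series (Es_term beta t)).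

Definition u (R : realType) (beta x t : R) : R :=
  Ec beta t * cos (x / 3) + Es beta t * sin (x / 3).

Definition A (R : realType) (beta t : R) : R :=
  Num.sqrt (Ec beta t ^+ 2 + Es beta t ^+ 2).

(* The tangent equation determines phi / 3 only modulo pi, and is meaningful
   only where Ec does not vanish; the last clause selects the branch. *)
Definition is_phase (R : realType) (beta T : R) (phi : R -> R) : Prop :=
  [/\ {within `[0, T[, continuous phi},
      phi 0 = 0,
      forall t, 0 <= t < T -> Ec beta t != 0 ->
        tan (phi t / 3) = Es beta t / Ec beta t &
      forall x t, 0 <= t < T ->
        u beta x t = A beta t * cos ((x - phi t) / 3)].

Definition gamma_gap (R : realType) (beta : R) : R :=
  1 / Gamma (1 + 2 * beta) - 1 / (2 * Gamma (1 + beta) ^+ 2).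

(* Main.v *)
(* The two series are power series in z = t^(2 beta) (times t^beta for Es), so
   convergence at one positive time bounds their tails, and c_0 = c_1 = c_2 = 1
   gives, with s = sqrt (3/2),
     Ec = s - s z / (9 Gamma (1 + 2 beta)) + O(z^2),
     Es = t^beta (s / (3 Gamma (1 + beta)) + O(z)).
   The amplitude follows by expanding the square root, and the phase from
   phi / 3 = atan (Es / Ec), valid near 0 by continuity of phi.
   The sign of gamma_gap says Gamma (1 + 2 beta) <= 2 Gamma (1 + beta)^2. Both
   this and the auxiliary bound 2^(beta - 1) < Gamma (1 + beta) come from the
   log-convexity of Gamma between 1 + beta and 3, obtained by integrating the
   weighted arithmetic-geometric mean inequality, together with Gamma 2 = 1 and
   Gamma 3 = 2. *)

Require Import Defs.
From HB Require Import structures.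
From mathcomp Require Import all_boot all_order all_algebra.
From mathcomp Require Import all_classical all_reals all_analysis.
From mathcomp Require Import measurable_realfun.
From mathcomp Require Import ring lra.

Import Order.TTheory GRing.Theory Num.Theory.
Import numFieldNormedType.Exports.

Local Open Scope classical_set_scope.
Local Open Scope ring_scope.

Set Implicit Arguments.
Unset Strict Implicit.

(** * Integrals of quadratic polynomials against the decaying exponential *)

Lemma cvg_quadratic_expRN (R : realType) (a b d : R) :
  0 <= a -> 0 <= b -> 0 <= d ->
  (a + b * s + d * s ^+ 2) * expR (- s) @[s --> +oo] --> (0 : R).
Proof.
move=> a0 b0 d0; apply/cvgrPdist_le => e e0; near=> s.
have s1 : 1 <= s by near: s; apply: nbhs_pinfty_ge; rewrite num_real.
(* For [1 <= s] the polynomial is at most [(a + b + d) * s ^+ 2], while [expR s] is at least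
   [s ^+ 3 / 24]; beyond this threshold their quotient is at most [e]. *)
have se : 24 * (a + b + d) / e <= s.
  by near: s; apply: nbhs_pinfty_ge; rewrite num_real.
have s0 : 0 < s by lra.
have E : s ^+ 3 / 24 <= expR s.
  have : 1 + s ^+ 3 / 6 <= expR s by exact: (@expR_ge1Dxn _ s 2 (ltW s0)).
  have : 0 <= s ^+ 3 by rewrite exprn_ge0 // ltW.
  lra.
have q0 : 0 <= a + b * s + d * s ^+ 2.
  by rewrite !addr_ge0 ?mulr_ge0 ?exprn_ge0 ?(ltW s0).
rewrite sub0r normrN ger0_norm ?mulr_ge0 ?expR_ge0 // expRN.
rewrite ler_pdivrMr ?expR_gt0 //.
have s2 : s <= s ^+ 2 by rewrite expr2 ler_peMr // ltW.
have q1 : a + b * s + d * s ^+ 2 <= (a + b + d) * s ^+ 2.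
  rewrite !mulrDl lerD2r lerD //.
    by rewrite ler_peMr // (le_trans s1).
  by rewrite ler_wpM2l.
apply: (le_trans q1); apply: le_trans (ler_wpM2l (ltW e0) E).
have -> : e * (s ^+ 3 / 24) = s * (e / 24) * s ^+ 2 by field.
rewrite ler_wpM2r ?exprn_ge0 ?(ltW s0) // mulrA ler_pdivlMr //.
by rewrite -ler_pdivrMr // mulrC.
Unshelve. all: by end_near. Qed.

Section quadratic_exponential.
Context {R : realType}.
Notation mu := (@lebesgue_measure R).
Implicit Types a b d : R.

(** Differentiating $-P e^{-s}$ gives $(P - P') e^{-s}$, so an antiderivative of $q e^{-s}$ is
    obtained by solving $P - P' = q$. *)
Lemma is_derive_quadratic_expRN a b d (s : R) :
  is_derive s 1 (fun s => - ((a + b * s + d * s ^+ 2) * expR (- s)))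
    (((a - b) + (b - 2 * d) * s + d * s ^+ 2) * expR (- s)).
Proof.
pose P : {poly R} := a%:P + b%:P * 'X + d%:P * 'X ^+ 2.
have PE x : P.[x] = a + b * x + d * x ^+ 2 by rewrite /P !hornerE.
have -> : (fun s => - ((a + b * s + d * s ^+ 2) * expR (- s))) =
          - ((horner P) * (expR \o -%R)).
  by apply/funext => x; rewrite /= -PE.
have dP : is_derive s 1 (horner P) (b + 2 * d * s).
  apply: (is_derive_eq (is_derive_poly P s)); rewrite /P.
  rewrite !(derivD, derivM, derivC, derivX, derivXn) /= !hornerE /=; ring.
apply: is_derive_eq; rewrite /= PE /GRing.scale /=; ring.
Qed.

Lemma integral_quadratic_expRN a b d : 0 <= a -> 0 <= b -> 0 <= d ->
  (\int[mu]_(s in `]0%R, +oo[) ((a + b * s + d * s ^+ 2) * expR (- s))%:E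
    = (a + b + 2 * d)%:E)%E.
Proof.
move=> a0 b0 d0.
have cf : continuous (fun s : R => (a + b * s + d * s ^+ 2) * expR (- s)).
  move=> s; apply: cvgM; last first.
    by apply: continuous_comp; [exact: continuousN|exact: continuous_expR].
  apply: cvgD; first apply: cvgD.
  - exact: cvg_cst.
  - by apply: cvgM; [exact: cvg_cst|exact: cvg_id].
  - by apply: cvgM; [exact: cvg_cst|exact: exprn_continuous].
(* The endpoint 0 is added, a null set, because the fundamental theorem is applied on the closed
   half-line. *)
rewrite integral_itv_obnd_cbnd; last first.
  apply/measurable_EFinP; apply: measurable_funTS.
  exact: continuous_measurable_fun.
(* The solution of $P - P' = q$ is $P = q + q' + q''$; its value at 0 is the integral. *)
pose F := fun s : R => - (((a + b + 2 * d) + (b + 2 * d) * s + d * s ^+ 2) * expR (- s)).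
have dF (s : R) : is_derive s 1 F ((a + b * s + d * s ^+ 2) * expR (- s)).
  apply: (is_derive_eq (is_derive_quadratic_expRN _ _ _ s)); congr (_ * _); ring.
rewrite (@ge0_continuous_FTC2y _ _ F 0 0).
- rewrite /F /= oppr0 expR0 -EFinB; congr (_%:E); ring.
- by move=> x x0; rewrite mulr_ge0 ?expR_ge0 // !addr_ge0 ?mulr_ge0 ?exprn_ge0.
- exact: continuous_subspaceT.
- rewrite -oppr0; apply: cvgN; apply: cvg_quadratic_expRN => //.
  + by rewrite !addr_ge0 // mulr_ge0.
  + by rewrite !addr_ge0 // mulr_ge0.
- by move=> x _; exact: ex_derive.
- apply: cvg_at_right_filter.
  exact/differentiable_continuous/derivable1_diffP/ex_derive.
- by move=> x _; rewrite derive1E; apply: derive_val.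
Qed.

End quadratic_exponential.

(** * The Gamma function on [1, 3]: special values, integrability, positivity *)

Section Gamma.
Context {R : realType}.
Notation mu := (@lebesgue_measure R).
Implicit Types a b : R.

Let D : set R := `]0, +oo[.

Let mD : measurable (D : set (measurableTypeR R)). Proof. exact: measurable_itv. Qed.

Let gt0D s : D s -> 0 < s. Proof. by rewrite /D /= in_itv /= andbT. Qed.

(** The integrand is nonnegative on the half-line, so its norm has the finite integral already
    computed. Such functions serve to dominate the Gamma integrand. *)
Lemma integrable_quadratic_expRN a b (d : R) : 0 <= a -> 0 <= b -> 0 <= d ->
  mu.-integrable `]0, +oo[
    (EFin \o (fun s => (a + b * s + d * s ^+ 2) * expR (- s))).
Proof.
move=> a0 b0 d0; apply/integrableP; split.
  apply/measurable_EFinP; apply: measurable_funM; last first.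
    by apply: measurableT_comp => //; exact: measurable_funN.
  by apply: measurable_funD; [apply: measurable_funD => //|];
    apply: measurable_funM => //; exact: measurable_funX.
rewrite [ltLHS](_ : _ = (a + b + 2 * d)%:E) ?ltry //.
rewrite -integral_quadratic_expRN //; apply: eq_integral => s.
rewrite inE => /gt0D /ltW s0 /=; rewrite ger0_norm //.
by rewrite mulr_ge0 ?expR_ge0 // !addr_ge0 ?mulr_ge0 ?exprn_ge0.
Qed.

Lemma Gamma1D a : Gamma (1 + a) =
  \int[mu]_(s in `]0, +oo[) (s `^ a * expR (- s)).
Proof. by rewrite /Gamma addrAC subrr add0r. Qed.

Lemma Rintegral_quadratic_expRN (f : R -> R) a b (d : R) : 0 <= a -> 0 <= b -> 0 <= d ->
  (forall s, 0 < s -> f s = a + b * s + d * s ^+ 2) ->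
  \int[mu]_(s in `]0, +oo[) (f s * expR (- s)) = a + b + 2 * d.
Proof.
move=> a0 b0 d0 fE.
transitivity (\int[mu]_(s in D) ((a + b * s + d * s ^+ 2) * expR (- s))).
  by apply: eq_Rintegral => s; rewrite inE => /gt0D s0; rewrite fE.
by rewrite /Rintegral integral_quadratic_expRN.
Qed.

Lemma Gamma_1 : Gamma (1 : R) = 1.
Proof.
rewrite -[X in Gamma X]addr0 Gamma1D.
rewrite (@Rintegral_quadratic_expRN _ 1 0 0) ?mulr0 ?addr0 // => s s0.
by rewrite powRr0 !mul0r !addr0.
Qed.

Lemma Gamma_2 : Gamma (1 + 1 : R) = 1.
Proof.
rewrite Gamma1D (@Rintegral_quadratic_expRN _ 0 1 0) ?mulr0 ?addr0 ?add0r // => s s0.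
by rewrite powRr1 ?(ltW s0) // !mul0r mul1r add0r addr0.
Qed.

Lemma Gamma_3 : Gamma (1 + 2 : R) = 2.
Proof.
rewrite Gamma1D (@Rintegral_quadratic_expRN _ 0 0 1) ?mulr1 ?add0r // => s s0.
by rewrite powR_mulrn ?(ltW s0) // !mul0r mul1r !add0r.
Qed.

(** Domination by $(1 + s^2) e^{-s}$: the power $s^a$ is at most 1 for $s \le 1$ and at most $s^2$
    for $s > 1$. *)
Lemma integrable_Gamma a : 0 <= a <= 2 ->
  mu.-integrable `]0, +oo[ (EFin \o (fun s => s `^ a * expR (- s))).
Proof.
move=> /andP[a0 a2].
apply: (@le_integrable _ _ _ mu D mD _
  (EFin \o (fun s => (1 + 0 * s + 1 * s ^+ 2) * expR (- s)))).
- apply/measurable_EFinP; apply: measurable_funM.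
    by apply: measurable_funTS; exact: measurable_powR.
  by apply: measurableT_comp => //; exact: measurable_funN.
- move=> s /gt0D s0; rewrite /= lee_fin.
  have P : 0 <= 1 + 0 * s + 1 * s ^+ 2.
    by rewrite mul0r mul1r addr0 addr_ge0 ?exprn_ge0 ?(ltW s0).
  rewrite !ger0_norm ?mulr_ge0 ?expR_ge0 ?powR_ge0 // ler_wpM2r ?expR_ge0 //.
  rewrite mul0r mul1r addr0; have [s1|s1] := leP s 1.
    rewrite (@le_trans _ _ 1) ?lerDl ?exprn_ge0 ?(ltW s0) //.
    by rewrite -(powRr0 s) ger_powR ?s0.
  rewrite -powR_mulrn ?(ltW s0) // (@le_trans _ _ (s `^ 2)) ?lerDr //.
  by rewrite ler_powR // ltW.
- exact: integrable_quadratic_expRN.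
Qed.

(** If the integral were zero, [f] would vanish off a null set; that null set would contain the
    interval from [s0] to [s1], which has positive measure. *)
Lemma Rintegral_gt0 (f : R -> R) (s0 s1 : R) : 0 <= s0 -> s0 < s1 ->
  mu.-integrable `]0, +oo[ (EFin \o f) ->
  (forall s, 0 < s -> 0 <= f s) -> (forall s, s0 < s < s1 -> 0 < f s) ->
  0 < \int[mu]_(s in `]0, +oo[) f s.
Proof.
move=> s0_ge0 s01 intf f0 fpos.
rewrite lt_def Rintegral_ge0 ?andbT; last by move=> s /gt0D /f0.
apply/eqP => I0.
have mf := measurable_int _ intf.
have : (\int[mu]_(x in D) `|(EFin \o f) x| = 0)%E.
  transitivity (\int[mu]_(x in D) (EFin \o f) x)%E.
    by apply: eq_integral => s; rewrite inE => /gt0D /f0 ?; rewrite /= ger0_norm.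
  rewrite -(fineK (integrable_fin_num mD intf)).
  by move: I0; rewrite /Rintegral => ->.
move/(ae_eq_integral_abs mu mD mf) => [N [mN N0 sN]].
have : (mu `]s0, s1[%classic <= mu N)%E.
  have mI : measurable (`]s0, s1[%classic : set (measurableTypeR R)).
    exact: measurable_itv.
  apply: le_measure; rewrite ?inE //.
  apply: subset_trans sN => s /=; rewrite in_itv /= => /andP[s0s ss1] H.
  have /H /eqP : D s by rewrite /D /= in_itv /= andbT (le_lt_trans s0_ge0).
  by rewrite /= eqe gt_eqF // fpos // s0s.
by rewrite N0 lebesgue_measure_itv /= lte_fin s01 -EFinB lee_fin leNgt subr_gt0 s01.
Qed.

Lemma Gamma_gt0 a : 0 <= a <= 2 -> 0 < Gamma (1 + a).
Proof.
move=> ha; rewrite Gamma1D; apply: (@Rintegral_gt0 _ 0 1) => //.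
- exact: integrable_Gamma.
- by move=> s s0; rewrite mulr_ge0 ?powR_ge0 ?expR_ge0.
- by move=> s /andP[s0 _]; rewrite mulr_gt0 ?powR_gt0 ?expR_gt0.
Qed.

(** Three terms suit a weighted arithmetic-geometric mean inequality: two for the arithmetic mean
    and one for the geometric mean. *)
Lemma Gamma_lincomb (p q r a b d : R) :
  0 <= a <= 2 -> 0 <= b <= 2 -> 0 <= d <= 2 ->
  let f s := p * (s `^ a * expR (- s)) + q * (s `^ b * expR (- s))
             + r * (s `^ d * expR (- s)) in
  mu.-integrable `]0, +oo[ (EFin \o f) /\
  \int[mu]_(s in `]0, +oo[) f s =
    p * Gamma (1 + a) + q * Gamma (1 + b) + r * Gamma (1 + d).
Proof.
move=> ha hb hd f.
have intZ k e : 0 <= e <= 2 ->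
    mu.-integrable D (EFin \o (fun s => k * (s `^ e * expR (- s)))).
  move=> he; have := integrableZl mD k (integrable_Gamma he).
  by apply: eq_integrable => // s _; rewrite /= EFinM.
have intpq : mu.-integrable D (EFin \o (fun s =>
    p * (s `^ a * expR (- s)) + q * (s `^ b * expR (- s)))).
  have := integrableD mD (intZ p _ ha) (intZ q _ hb).
  by apply: eq_integrable => // s _; rewrite /= EFinD.
split.
  have := integrableD mD intpq (intZ r _ hd).
  by apply: eq_integrable => // s _; rewrite /= EFinD.
rewrite !Gamma1D RintegralD //; last exact: intZ.
rewrite RintegralD //; [|exact: intZ|exact: intZ].
by rewrite !RintegralZl //; exact: integrable_Gamma.
Qed.

End Gamma.

(** * Convexity inequalities and the sign of the Gamma gap *)

Section Gamma_gap.
Context {R : realType}.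

(** The graph lies above its tangent at the weighted mean [m], and averaging the two tangent values
    gives back [expR m]. *)
Lemma expR_convex (l x y : R) : 0 <= l <= 1 ->
  expR ((1 - l) * x + l * y) <= (1 - l) * expR x + l * expR y.
Proof.
move=> /andP[l0 l1]; set m := (_ + _).
have E z : expR m * (1 + (z - m)) <= expR z.
  have -> : expR z = expR m * expR (z - m) by rewrite -expRD subrKC.
  by rewrite ler_wpM2l ?expR_ge0 ?expR_ge1Dx.
have -> : expR m = (1 - l) * (expR m * (1 + (x - m))) + l * (expR m * (1 + (y - m))).
  by rewrite /m; ring.
by rewrite lerD // ler_wpM2l ?subr_ge0.
Qed.

(** The same tangent argument, strict because [x] and [y] both differ from [m]. *)
Lemma expR_strictly_convex (l x y : R) : 0 < l < 1 -> x != y ->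
  expR ((1 - l) * x + l * y) < (1 - l) * expR x + l * expR y.
Proof.
move=> /andP[l0 l1] xy; set m := (_ + _).
have E z : z != m -> expR m * (1 + (z - m)) < expR z.
  move=> zm; have -> : expR z = expR m * expR (z - m) by rewrite -expRD subrKC.
  by rewrite ltr_pM2l ?expR_gt0 // expR_gt1Dx // subr_eq0.
have -> : expR m = (1 - l) * (expR m * (1 + (x - m))) + l * (expR m * (1 + (y - m))).
  by rewrite /m; ring.
rewrite ltrD // ltr_pM2l ?subr_gt0 // E // -subr_eq0 /m.
  have -> : x - ((1 - l) * x + l * y) = l * (x - y) by ring.
  by rewrite mulf_neq0 ?subr_eq0 // gt_eqF.
have -> : y - ((1 - l) * x + l * y) = (1 - l) * (y - x) by ring.
by rewrite mulf_neq0 ?subr_eq0 ?(eq_sym y) // gt_eqF.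
Qed.

Lemma powRE (s a : R) : 0 < s -> s `^ a = expR (a * ln s).
Proof. by move=> s0; rewrite /powR gt_eqF. Qed.

(* Log-convexity of Gamma between 1 + beta and 3, evaluated at 2. *)
Lemma Gamma_gt_powR (beta : R) : 0 < beta < 1 ->
  expR ((beta - 1) * ln 2) < Gamma (1 + beta).
Proof.
move=> /andP[b0 b1]; have b2 : 2 - beta != 0 by rewrite gt_eqF //; lra.
(* Chosen so that $(1 - m)\beta + 2m = 1$: the argument 2 is the weighted mean of $1 + \beta$ and
   3. *)
pose m := (1 - beta) / (2 - beta).
have m1 : 1 - m = (2 - beta)^-1 by rewrite /m; field.
have m0 : 0 < m by rewrite divr_gt0; lra.
have m1p : 0 < 1 - m by rewrite m1 invr_gt0; lra.
(* The scalings $w = 2^{1 - \beta}$ of $s^\beta$ and $1/2$ of $s^2$ make the two terms coincide at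
   $s = 2$, so the inequality is strict for $0 < s < 2$. *)
pose w := expR ((1 - beta) * ln 2).
have [] := @Gamma_lincomb R ((1 - m) * w) (-1) (m / 2) beta 1 2; [lra|lra|lra|].
set f := (fun s => _ + _ + _) => intf fE.
have fs s : 0 < s -> f s = ((1 - m) * expR ((1 - beta) * ln 2 + beta * ln s)
     + m * expR (2 * ln s - ln 2)
     - expR ((1 - m) * ((1 - beta) * ln 2 + beta * ln s)
     + m * (2 * ln s - ln 2))) * expR (- s).
  move=> s0; rewrite /f !powRE // (expRD _ (- ln 2)) (expRN (ln 2)) lnK ?posrE //.
  have -> : (1 - m) * ((1 - beta) * ln 2 + beta * ln s) + m * (2 * ln s - ln 2)
      = 1 * ln s by rewrite /m; field.
  rewrite (expRD ((1 - beta) * ln 2)) -/w; ring.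
have : 0 < \int[lebesgue_measure]_(s in `]0, +oo[) f s.
  apply: (@Rintegral_gt0 _ _ 0 2) => //.
  - move=> s s0; rewrite fs // mulr_ge0 ?expR_ge0 // subr_ge0 expR_convex //.
    by rewrite (ltW m0) /= -subr_ge0 ltW.
  - move=> s /andP[s0 s2]; rewrite fs // mulr_gt0 ?expR_gt0 // subr_gt0.
    rewrite expR_strictly_convex //; first by rewrite m0 -subr_gt0.
    rewrite -subr_eq0.
    have -> : (1 - beta) * ln 2 + beta * ln s - (2 * ln s - ln 2)
      = (2 - beta) * (ln 2 - ln s) by ring.
    by rewrite mulf_neq0 // subr_eq0 gt_eqF // ltr_ln ?posrE.
rewrite fE Gamma_2 Gamma_3 {intf fE fs} => {f} H.
(* With $\Gamma(2) = 1$ and $\Gamma(3) = 2$, the positive integral equals $(1 - m)(w\,\Gamma(1 +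
   \beta) - 1)$. *)
have : (1 - m) * 1 < (1 - m) * (w * Gamma (1 + beta)) by lra.
rewrite ltr_pM2l // /w => {}H.
rewrite -(ltr_pM2l (expR_gt0 ((1 - beta) * ln 2))) -expRD.
by rewrite (_ : _ + _ = 0) ?expR0 //; ring.
Qed.

(* Log-convexity of Gamma between 1 + beta and 3, evaluated at 1 + 2 beta. *)
Lemma Gamma_double_lt (beta : R) : 0 < beta < 1 ->
  Gamma (1 + 2 * beta) < 2 * Gamma (1 + beta) ^+ 2.
Proof.
move=> hb; have := Gamma_gt_powR hb; move: hb => /andP[b0 b1].
set G := Gamma (1 + beta) => Glb.
have G0 : 0 < G by exact: lt_trans (expR_gt0 _) Glb.
have b2 : 2 - beta != 0 by rewrite gt_eqF //; lra.
(* Chosen so that $(1 - l)\beta + 2l = 2\beta$. *)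
pose l := beta / (2 - beta).
have l0 : 0 <= l by rewrite divr_ge0; lra.
have l1 : l <= 1 by rewrite /l ler_pdivrMr; lra.
(* The weighted geometric mean of $2G s^\beta$ and $G^2 s^2$ is $e^k s^{2\beta}$; with these
   scalings both terms integrate to $2G^2$. *)
pose k := (1 - l) * ln 2 + (1 + l) * ln G.
(* Positivity of [k] is equivalent to $2^{\beta - 1} < G$. It supplies the strictness, so plain
   convexity suffices below. *)
have k0 : 0 < k.
  have -> : k = 2 / (2 - beta) * ((1 - beta) * ln 2 + ln G) by rewrite /k /l; field.
  rewrite mulr_gt0 ?divr_gt0 //; first lra.
  have : (beta - 1) * ln 2 < ln G by rewrite -ltr_expR lnK.
  lra.
have [||| intf] :=
  @Gamma_lincomb R ((1 - l) * (2 * G)) (l * G ^+ 2) (- expR k) beta 2 (2 * beta);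
  [lra|lra|lra|].
rewrite Gamma_3 -/G => fE.
have I : 0 <= (1 - l) * (2 * G) * G + l * G ^+ 2 * 2 - expR k * Gamma (1 + 2 * beta).
  rewrite -[- (expR k * _)]mulNr -fE; apply: Rintegral_ge0 => s.
  rewrite /= in_itv /= andbT => s0.
  rewrite [leRHS](_ : _ = ((1 - l) * (2 * G * s `^ beta)
    + l * (G ^+ 2 * s `^ 2) - expR k * s `^ (2 * beta)) * expR (- s)); last by ring.
  rewrite mulr_ge0 ?expR_ge0 // subr_ge0 !powRE // -expRD.
  have -> : k + 2 * beta * ln s =
      (1 - l) * (ln 2 + ln G + beta * ln s) + l * (ln G + ln G + 2 * ln s).
    by rewrite /k /l; field.
  apply: le_trans (expR_convex _ _ _) _; first by rewrite l0.
  by rewrite !expRD !lnK ?posrE // expr2 !mulrA.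
have H : expR k * Gamma (1 + 2 * beta) <= 2 * G ^+ 2 by lra.
apply: lt_le_trans H.
have GG : 0 < Gamma (1 + 2 * beta) by apply: Gamma_gt0; clear -b0 b1; lra.
by rewrite ltr_pMl // expR_gt1.
Qed.

Lemma gamma_gap_ge0_eq0 (beta : R) : 0 < beta <= 1 ->
  0 <= gamma_gap beta /\ (gamma_gap beta = 0 <-> beta = 1).
Proof.
move=> /andP[b0]; rewrite le_eqVlt => /predU1P[->|b1].
  have -> : gamma_gap (1 : R) = 0.
    by rewrite /gamma_gap mulr1 Gamma_2 Gamma_3 expr1n mulr1 subrr.
  by [].
have hb : 0 < beta < 1 by rewrite b0.
have gap0 : 0 < gamma_gap beta.
  rewrite /gamma_gap !mul1r subr_gt0 ltf_pV2 ?posrE.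
  - exact: Gamma_double_lt.
  - by rewrite mulr_gt0 // exprn_gt0 // Gamma_gt0 //; lra.
  - by rewrite Gamma_gt0 //; lra.
split; first exact: ltW.
by split => H; [rewrite H ltxx in gap0|rewrite H ltxx in b1].
Qed.

End Gamma_gap.

(** * Elementary estimates: power series tails, arctangent, square root, quotient *)

(** Convergence at [r] bounds the terms there by some [B]; for $z \le r/2$ the terms are then
    dominated by a geometric sequence of ratio $q = z/r \le 1/2$, whose tail is at most $2B q^N$. *)
Lemma power_series_tail (R : realType) (a : nat -> R) (r : R) (N : nat) :
  0 < r -> cvgn (series (fun k => a k * r ^+ k)) ->
  exists2 M, 0 <= M & forall z, 0 <= z <= r / 2 ->
    cvgn (series (fun k => a k * z ^+ k)) ->
    `|limn (series (fun k => a k * z ^+ k)) - \sum_(0 <= k < N) a k * z ^+ k|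
      <= M * z ^+ N.
Proof.
move=> r0 /cvg_series_cvg_0 cv0.
have [B B0 aB] : exists2 B, 0 <= B & forall k, `|a k * r ^+ k| <= B.
  have /cvg_seq_bounded bnd : cvgn (fun k => a k * r ^+ k).
    by apply/cvg_ex; exists 0.
  have [B B0 aB] := pinfty_ex_gt0 bnd.
  by exists B; [exact: ltW|move=> k; exact: aB].
exists (2 * B / r ^+ N); first by rewrite divr_ge0 ?mulr_ge0 ?exprn_ge0 // ltW.
move=> z /andP[z0 zr] cvz; set S := series _.
pose q := z / r.
have q0 : 0 <= q by rewrite divr_ge0 // ltW.
have q2 : q <= 1 / 2 by rewrite /q ler_pdivrMr // mulrC mulrA mulr1.
have azq k : `|a k * z ^+ k| <= B * q ^+ k.
  have -> : a k * z ^+ k = a k * r ^+ k * q ^+ k.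
    by rewrite /q expr_div_n; field; rewrite expf_neq0 // gt_eqF.
  by rewrite normrM (ger0_norm (exprn_ge0 k q0)) ler_wpM2r ?exprn_ge0.
(* The factor $1 - 2^{-n}$ makes the induction close exactly: $2(1 - 2^{-n}) + 2^{-n} = 2(1 -
   2^{-(n+1)})$. *)
have Sn n : `|S (N + n)%N - S N| <= 2 * B * q ^+ N * (1 - (1 / 2) ^+ n).
  elim: n => [|n IH]; first by rewrite addn0 subrr normr0 expr0 subrr mulr0.
  rewrite addnS /S /series /= big_nat_recr //= -/(series _ (N + n)%N).
  rewrite addrAC; apply: (le_trans (ler_normD _ _)).
  apply: (le_trans (lerD IH (azq _))).
  have qn : q ^+ n <= (1 / 2) ^+ n by rewrite lerXn2r ?nnegrE.
  have := ler_wpM2l (mulr_ge0 B0 (exprn_ge0 N q0)) qn.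
  rewrite exprD exprS; lra.
have -> : 2 * B / r ^+ N * z ^+ N = 2 * B * q ^+ N.
  by rewrite /q expr_div_n mulrAC mulrA.
have bnd : 0 <= 2 * B * q ^+ N by rewrite !mulr_ge0 ?exprn_ge0.
have SN : \forall n \near \oo, `|S n - S N| <= 2 * B * q ^+ N.
  near=> n; have Nn : (N <= n)%N by near: n; exact: nbhs_infty_ge.
  rewrite -(subnKC Nn); apply: (le_trans (Sn _)).
  by rewrite ler_piMr // gerBl exprn_ge0.
rewrite -/(S N) ler_norml; apply/andP; split.
- rewrite lerBrDr; apply: limr_ge => //.
  by apply: filterS SN => n; rewrite ler_norml lerBrDr => /andP[].
- rewrite lerBlDr; apply: limr_le => //.
  by apply: filterS SN => n; rewrite ler_norml lerBlDr => /andP[].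
Unshelve. all: by end_near. Qed.

(** By oddness take $x \ge 0$; the mean value theorem gives $\arctan x = x/(1 + c^2)$ with $0 \le c
    \le x$, so the error is at most $c^2 x$. *)
Lemma norm_atanBid_le (R : realType) (x : R) : `|atan x - x| <= `|x| ^+ 3.
Proof.
wlog x0 : x / 0 <= x => [H|].
  have [/H//|/ltW x0] := leP 0 x.
  by have := H (- x); rewrite oppr_ge0 atanN -opprD !normrN; exact.
have ca : {within `[0, x], continuous (@atan R)}.
  by apply: continuous_subspaceT => y; exact: continuous_atan.
have [c + E] := MVT_segment x0 (fun y _ => is_derive1_atan y) ca.
rewrite in_itv /= => /andP[c0 cx].
move: E; rewrite atan0 !subr0 => ->.
have c2 : 0 <= c ^+ 2 by rewrite exprn_ge0.
have -> : (1 + c ^+ 2)^-1 * x - x = - (c ^+ 2 / (1 + c ^+ 2) * x).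
  by field; rewrite gt_eqF //; lra.
rewrite normrN !ger0_norm ?mulr_ge0 ?invr_ge0 ?addr_ge0 //.
rewrite (exprSr x 2%N) ler_wpM2r // ler_pdivrMr; last lra.
have : c ^+ 2 <= x ^+ 2 by rewrite lerXn2r ?nnegrE.
nra.
Qed.

(** The value of [d] makes the squares agree through order $y^2$, since $-2sd = b^2 - 2sa$. The
    difference of squares is then divided by the sum of the two roots. *)
Lemma sqrt_sum_sqr_expansion (R : realType) (s a b M y E F : R)
    (d := a - b ^+ 2 / (2 * s)) :
  0 < s -> 0 <= M -> 0 <= y <= 1 ->
  `|E - (s - a * y ^+ 2)| <= M * y ^+ 4 -> `|F - b * y| <= M * y ^+ 3 ->
  d * y ^+ 2 <= s / 2 ->
  `|Num.sqrt (E ^+ 2 + F ^+ 2) - (s - d * y ^+ 2)| <=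
  (a ^+ 2 + d ^+ 2 + M * (2 * s + 2 * `|a| + M) + M * (2 * `|b| + M))
    / (s / 2) * y ^+ 4.
Proof.
move=> s0 M0 /andP[y0 y1] HE HF dy.
set e := E - _ in HE; set g := F - _ in HF.
have EE : E = s - a * y ^+ 2 + e by rewrite /e; ring.
have FE : F = b * y + g by rewrite /g; ring.
have yn n : y ^+ n <= 1 by rewrite exprn_ile1.
have yn0 n : 0 <= y ^+ n by rewrite exprn_ge0.
have he : `|e * (2 * (s - a * y ^+ 2) + e)| <= M * y ^+ 4 * (2 * s + 2 * `|a| + M).
  rewrite normrM ler_pM //; apply: (le_trans (ler_normD _ _)).
  rewrite lerD //; last by rewrite (le_trans HE) // ler_piMr.
  rewrite normrM ger0_norm // -mulrDr ler_wpM2l //.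
  apply: (le_trans (ler_normB _ _)); rewrite (gtr0_norm s0) lerD2l normrM.
  by rewrite (ger0_norm (yn0 2%N)) ler_piMr.
have hg : `|g * (2 * (b * y) + g)| <= M * y ^+ 3 * (y * (2 * `|b| + M)).
  rewrite normrM ler_pM //; apply: (le_trans (ler_normD _ _)).
  rewrite mulrDr lerD //.
    by rewrite !normrM ger0_norm // (ger0_norm y0) mulrA mulrC.
  rewrite (le_trans HF) // (exprS y 2%N) mulrCA ler_wpM2l // ler_piMr //.
set K := a ^+ 2 + _ + _ + _.
set S := Num.sqrt _.
have S0 : 0 <= S by exact: sqrtr_ge0.
have SS : S ^+ 2 = E ^+ 2 + F ^+ 2 by rewrite sqr_sqrtr // addr_ge0 // sqr_ge0.
have diff : `|S ^+ 2 - (s - d * y ^+ 2) ^+ 2| <= K * y ^+ 4.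
  have -> : S ^+ 2 - (s - d * y ^+ 2) ^+ 2 =
    a ^+ 2 * y ^+ 4 - d ^+ 2 * y ^+ 4 + e * (2 * (s - a * y ^+ 2) + e)
    + g * (2 * (b * y) + g).
    by rewrite SS EE FE /d; field; rewrite gt_eqF.
  apply: (le_trans (ler_normD _ _)); apply: (le_trans (lerD (ler_normD _ _) hg)).
  apply: (le_trans (lerD (lerD (ler_normB _ _) he) (lexx _))).
  rewrite !(ger0_norm (mulr_ge0 (sqr_ge0 _) (yn0 4%N))).
  by rewrite le_eqVlt; apply/orP; left; apply/eqP; rewrite /K; ring.
(* The bound on [d * y ^+ 2] keeps the approximate root above [s / 2], and [S] is nonnegative. *)
have den : s / 2 <= S + (s - d * y ^+ 2) by lra.
rewrite mulrAC ler_pdivlMr ?divr_gt0 //; apply: le_trans diff.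
rewrite subr_sqr normrM ler_wpM2l //.
by rewrite ger0_norm // (le_trans _ den) // divr_ge0 // ltW.
Qed.

(** Over the common denominator [s * E], which is at least [s ^+ 2 / 2], the terms linear in [y]
    cancel and the numerator is of order $y^3$. *)
Lemma quotient_expansion (R : realType) (s a b M y E F : R)
    (K := (s * M + `|b| * (`|a| + M)) / (s ^+ 2 / 2)) :
  0 < s -> 0 <= M -> 0 <= y <= 1 ->
  `|E - (s - a * y ^+ 2)| <= M * y ^+ 4 -> `|F - b * y| <= M * y ^+ 3 ->
  s / 2 <= E -> `|F / E - b / s * y| <= K * y ^+ 3.
Proof.
move=> s0 M0 /andP[y0 y1] HE HF Es.
have E0 : 0 < E by apply: lt_le_trans Es; rewrite divr_gt0.
set e := E - _ in HE; set g := F - _ in HF.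
have yn n : y ^+ n <= 1 by rewrite exprn_ile1.
have yn0 n : 0 <= y ^+ n by rewrite exprn_ge0.
have -> : F / E - b / s * y = (s * g + y * (b * (a * y ^+ 2 - e))) / (s * E).
  by rewrite /g /e; field; rewrite !gt_eqF.
have num : `|s * g + y * (b * (a * y ^+ 2 - e))| <=
    (s * M + `|b| * (`|a| + M)) * y ^+ 3.
  apply: (le_trans (ler_normD _ _)); rewrite mulrDl lerD //.
    by rewrite normrM (gtr0_norm s0) -mulrA ler_wpM2l // ltW.
  rewrite !normrM (ger0_norm y0) (exprS y 2%N) [leRHS]mulrCA ler_wpM2l //.
  rewrite -mulrA ler_wpM2l //; apply: (le_trans (ler_normB _ _)).
  rewrite mulrDl lerD //.
    by rewrite normrM (ger0_norm (yn0 2%N)).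
  by rewrite (le_trans HE) // (exprD y 2%N 2%N) mulrA ler_piMr // mulr_ge0.
have den : s ^+ 2 / 2 <= s * E.
  by rewrite expr2 -mulrA ler_wpM2l // ltW.
have sE0 : 0 < s * E by rewrite mulr_gt0.
rewrite normrM normfV (gtr0_norm sE0) ler_pdivrMr // (le_trans num) //.
have K0 : 0 <= K * y ^+ 3.
  rewrite mulr_ge0 // divr_ge0 // ?divr_ge0 ?sqr_ge0 //.
  by rewrite addr_ge0 ?mulr_ge0 ?addr_ge0 // ltW.
apply: le_trans (ler_wpM2l K0 den).
by rewrite /K mulrAC divfK // gt_eqF // divr_gt0 // exprn_gt0.
Qed.

(** * The first coefficients and the passage to big-O *)

Lemma c_rec_0 (R : realType) (beta : R) (d : nat -> R) :
  d 0%N = 1 -> c_rec beta d 0 = 1.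
Proof.
move=> d0; rewrite /c_rec !big_ord1 big_mkcond big_ord1 /= /sigma /= d0.
by rewrite mulr0 addr0 Gamma_1 !expr0 invr1 !mulr1 divr1 mulr1.
Qed.

Lemma sum_triples_1 (V : zmodType) (F : nat -> nat -> nat -> V) :
  \sum_(n1 < 2) \sum_(n2 < 2) \sum_(n3 < 2 | (n1 + n2 + n3 == 1)%N) F n1 n2 n3 =
  F 0 0 1 + F 0 1 0 + F 1 0 0.
Proof.
under eq_bigr do under eq_bigr do rewrite big_mkcond.
by do 3 rewrite ?big_ord_recl ?big_ord0 /=; rewrite !addr0 add0r.
Qed.

(** The triples are the three orderings of (0, 0, 1). Each has [sigma] equal to 1 and, after the
    Gamma factors cancel, contributes 1/3. *)
Lemma c_rec_1 (R : realType) (beta : R) (d : nat -> R) : 0 <= beta <= 2 ->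
  d 0%N = 1 -> d 1%N = 1 -> c_rec beta d 1 = 1.
Proof.
move=> hbeta d0 d1; have G0 := Gamma_gt0 hbeta; rewrite /c_rec.
rewrite (sum_triples_1 (fun n1 n2 n3 =>
  ((-1) ^+ (n1./2 + n2./2 + n3./2)%N * 3 ^- sigma n1 n2 n3
     * Gamma (1 + beta * 1%:R) * d n1 * d n2 * d n3)
  / (Gamma (1 + beta * n1%:R) * Gamma (1 + beta * n2%:R)
     * Gamma (1 + beta * n3%:R)))).
rewrite d0 d1 !mulr0 !mulr1 !addr0 Gamma_1; move: (Gamma _) G0 => G G0.
by rewrite /sigma /= !expr0 !expr1; field; rewrite gt_eqF.
Qed.

(** Coefficients of [Ec] as a power series in $z = t^{2\beta}$. *)
Definition Ec_coef (R : realType) (beta : R) (k : nat) : R := (-1) ^+ k *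
  (c beta (2 * k)%N * 2 `^ (- (1 / 2)) * 3 `^ (- (2 * k%:R - 1 / 2)))
  / Gamma (1 + 2 * beta * k%:R).

(** Coefficients of [Es] in the same variable $z$, after a factor $t^\beta$ is taken out. *)
Definition Es_coef (R : realType) (beta : R) (k : nat) : R := (-1) ^+ k *
  (c beta (2 * k + 1)%N * 2 `^ (- (1 / 2)) * 3 `^ (- (2 * k%:R + 1 / 2)))
  / Gamma (1 + beta * (2 * k%:R + 1)).

(** The relation asks for the bound with every sufficiently large constant; the bound with [K]
    implies it for each larger one. *)
Lemma eqaddO_at_right (R : realType) (x K : R) (f g e : R -> R) :
  (\forall t \near x^'+, `|f t - g t| <= K * `|e t|) ->
  f = g +O_ (x^'+) e.
Proof.
move=> H; apply/eqaddOP; near=> k.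
have Kk : K <= k by near: k; apply: nbhs_pinfty_ge; rewrite num_real.
by apply: filterS H => t /le_trans; apply; rewrite ler_wpM2r.
Unshelve. all: by end_near. Qed.

(** * Expansions of the two series, the amplitude and the phase *)

Section expansions.
Context {R : realType}.
Variable beta : R.
Hypothesis hbeta : 0 < beta < 1.

Local Notation G1 := (Gamma (1 + beta)).
Local Notation G2 := (Gamma (1 + 2 * beta)).
Local Notation s := (Num.sqrt (3 / 2)).

Let G1_gt0 : 0 < G1.
Proof. by rewrite Gamma_gt0 //; move: hbeta => /andP[? ?]; lra. Qed.

Let G2_gt0 : 0 < G2.
Proof. by rewrite Gamma_gt0 //; move: hbeta => /andP[? ?]; lra. Qed.

Let s_gt0 : 0 < s :> R.
Proof. by rewrite sqrtr_gt0; lra. Qed.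

Lemma c_1 : c beta 1%N = 1.
Proof. by rewrite cS c_rec_0. Qed.

Lemma c_2 : c beta 2%N = 1.
Proof.
rewrite cS c_rec_1 ?c_1 //; move: hbeta => /andP[? ?]; lra.
Qed.

Let sqrt32E : 2 `^ (- (1 / 2)) * 3 `^ (1 / 2) = s :> R.
Proof.
rewrite powRN !mul1r !powR12_sqrt // sqrtrM // sqrtrV //.
by rewrite mulrC.
Qed.

Let powR_natM (t : R) n : t `^ (n%:R * beta) = (t `^ beta) ^+ n.
Proof. by rewrite mulrC powRrM powR_mulrn ?powR_ge0. Qed.

Let sqr_powR (t : R) : t `^ (2 * beta) = (t `^ beta) ^+ 2.
Proof. exact: (powR_natM t 2%N). Qed.

Let Ec_termE t :
  Ec_term beta t = fun k => Ec_coef beta k * ((t `^ beta) ^+ 2) ^+ k.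
Proof.
apply/funext => k; rewrite /Ec_term /Ec_coef powRrM powR_mulrn ?powR_ge0 //.
by rewrite sqr_powR; ring.
Qed.

Let Es_termE t : 0 < t ->
  Es_term beta t = fun k => t `^ beta * (Es_coef beta k * ((t `^ beta) ^+ 2) ^+ k).
Proof.
move=> t0; apply/funext => k; rewrite /Es_term /Es_coef.
have -> : beta * (2 * k%:R + 1) = 2 * beta * k%:R + beta by ring.
rewrite powRD ?(gt_eqF t0) ?implybT // powRrM powR_mulrn ?powR_ge0 //.
by rewrite sqr_powR; ring.
Qed.

Let Ec_coef0 : Ec_coef beta 0 = s.
Proof.
rewrite /Ec_coef muln0 c0 !mulr0 addr0 Gamma_1 sub0r opprK -sqrt32E expr0.
by rewrite divr1 !mul1r.
Qed.

Let Ec_coef1 : Ec_coef beta 1 = - (s / (9 * G2)).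
Proof.
rewrite /Ec_coef muln1 c_2 !mulr1 -sqrt32E.
have -> : 3 `^ (- (2 - 1 / 2)) = 3 `^ (1 / 2) / 3 ^+ 2 :> R.
  have -> : - (2 - 1 / 2) = 1 / 2 - 2%:R :> R by field.
  by rewrite powRD ?powR_invn // pnatr_eq0 implybT.
by rewrite expr1; field; rewrite gt_eqF.
Qed.

Let Es_coef0 : Es_coef beta 0 = s / (3 * G1).
Proof.
rewrite /Es_coef muln0 add0n c_1 !mulr0 !add0r mulr1 -sqrt32E expr0.
have -> : 3 `^ (- (1 / 2)) = 3 `^ (1 / 2) / 3 :> R.
  have -> : - (1 / 2) = 1 / 2 - 1 :> R by field.
  by rewrite powRD ?powR_inv1 // pnatr_eq0 implybT.
by rewrite !mul1r; field; rewrite gt_eqF.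
Qed.

Let powR_near0 (e : R) : 0 < e -> \forall t \near 0^'+, (t `^ beta) <= e.
Proof.
move: hbeta => /andP[b0 _] e0.
have /cvgr0Pnorm_le := powR_cvg0 b0 => /(_ _ e0).
by apply: filterS => t; rewrite ger0_norm // powR_ge0.
Qed.

(** The tail estimate in $z = t^{2\beta}$ is applied after two terms of [Ec] and one term of [Es];
    the factor $t^\beta$ raises the latter error from $t^{2\beta}$ to $t^{3\beta}$. *)
Lemma Ec_Es_expansion (T : R) : 0 < T -> series_converge_on beta T ->
  exists2 M, 0 <= M & \forall t \near 0^'+,
    `|Ec beta t - (s - s / (9 * G2) * (t `^ beta) ^+ 2)| <= M * (t `^ beta) ^+ 4
    /\ `|Es beta t - s / (3 * G1) * t `^ beta| <= M * (t `^ beta) ^+ 3.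
Proof.
move=> T0 cvT.
have cvE t : 0 < t < T ->
    cvgn (series (fun k => Ec_coef beta k * ((t `^ beta) ^+ 2) ^+ k)) /\
    cvgn (series (fun k => Es_coef beta k * ((t `^ beta) ^+ 2) ^+ k)).
  move=> /andP[t0 tT]; have [|cE sE] := cvT t; first by rewrite ltW.
  split; first by move: cE; rewrite Ec_termE.
  have y0 : t `^ beta != 0 by rewrite gt_eqF // powR_gt0.
  (* Dividing the convergent series for [Es] by the nonzero $t^\beta$ leaves a pure power series in
     $z$. *)
  have <- : (t `^ beta)^-1 *: Es_term beta t =
      fun k => Es_coef beta k * ((t `^ beta) ^+ 2) ^+ k.
    by rewrite Es_termE //; apply/funext => k; exact: mulKf.
  exact: is_cvg_seriesZ.
pose t1 := T / 2; have t1T : 0 < t1 < T by rewrite /t1; lra.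
have t10 : 0 < t1 by move: t1T => /andP[].
(* The reference radius is the value of $z$ at the time [T / 2], where convergence is known. *)
pose r := (t1 `^ beta) ^+ 2.
have r0 : 0 < r by rewrite exprn_gt0 // powR_gt0.
have [cvEc cvEs] := cvE _ t1T.
have [M1 M10 HM1] := @power_series_tail _ _ _ 2 r0 cvEc.
have [M2 M20 HM2] := @power_series_tail _ _ _ 1 r0 cvEs.
exists (M1 + M2); first exact: addr_ge0.
near=> t.
have t0 : 0 < t by near: t; exact: nbhs_right_gt.
have tT : t < T by near: t; exact: nbhs_right_lt.
have [cc cs] : _ /\ _ := cvE t (introT andP (conj t0 tT)).
set y := t `^ beta in cc cs *.
have y0 : 0 <= y by exact: powR_ge0.
have yr : 0 <= y ^+ 2 <= r / 2.
  rewrite exprn_ge0 //= (@le_trans _ _ (Num.sqrt (r / 2) ^+ 2)) //.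
    rewrite lerXn2r ?nnegrE ?sqrtr_ge0 // /y; near: t; apply: powR_near0.
    by rewrite sqrtr_gt0 divr_gt0.
  by rewrite sqr_sqrtr // divr_ge0 // ltW.
split.
- have := HM1 _ yr cc; rewrite big_nat_recr //= big_nat1 Ec_coef0 Ec_coef1.
  rewrite expr0 mulr1 expr1 mulNr -[(y ^+ 2) ^+ 2]exprM /Ec Ec_termE -/y.
  move=> /le_trans -> //.
  by rewrite ler_wpM2r ?exprn_ge0 // lerDl.
- have := HM2 _ yr cs; rewrite big_nat1 Es_coef0 expr0 mulr1 expr1 => H.
  have -> : Es beta t = y * limn (series (fun k => Es_coef beta k * (y ^+ 2) ^+ k)).
    by rewrite /Es Es_termE // -/y; exact: lim_seriesZ.
  rewrite [_ / _ * y]mulrC -mulrBr normrM (ger0_norm y0).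
  apply: (le_trans (ler_wpM2l y0 H)).
  rewrite mulrCA -exprS ler_wpM2r ?exprn_ge0 // lerDr //.
Unshelve. all: by end_near. Qed.

Lemma amplitude_expansion (T : R) : 0 < T -> series_converge_on beta T ->
  A beta = (fun t => s - 1 / (3 * Num.sqrt 6) * gamma_gap beta * t `^ (2 * beta))
           +O_ (0^'+) (fun t => t `^ (4 * beta)).
Proof.
move=> T0 cvT; have [M M0 HM] := Ec_Es_expansion T0 cvT.
set a := s / (9 * G2) in HM; set b := s / (3 * G1) in HM.
pose d := a - b ^+ 2 / (2 * s).
(* The coefficient matches because $\sqrt6\,\sqrt{3/2} = 3$. *)
have dE : 1 / (3 * Num.sqrt 6) * gamma_gap beta = d.
  have s6 : Num.sqrt 6 = 3 / s :> R.
    apply: (mulIf (lt0r_neq0 s_gt0)); rewrite divfK ?gt_eqF // -sqrtrM //.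
    have -> : 6 * (3 / 2) = 3 ^+ 2 :> R by field.
    by rewrite sqrtr_sqr ger0_norm.
  rewrite s6 /d /a /b /gamma_gap; move: (Gamma _) (Gamma _) (Num.sqrt _)
    G1_gt0 G2_gt0 s_gt0 => g1 g2 r g1_gt0 g2_gt0 r_gt0.
  by field; rewrite !gt_eqF.
apply: (@eqaddO_at_right _ _ ((a ^+ 2 + d ^+ 2 + M * (2 * s + 2 * `|a| + M)
  + M * (2 * `|b| + M)) / (s / 2))).
(* This threshold on $t^\beta$ ensures $d\,t^{2\beta} \le s/2$; adding 1 to the denominator keeps it
   nonzero. *)
have e0 : 0 < s / 2 / (`|d| + 1).
  by rewrite !divr_gt0 // ltr_wpDl.
move: HM; apply: filter_app; near=> t => -[HEc HEs].
have y0 : 0 <= t `^ beta by exact: powR_ge0.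
have y1 : t `^ beta <= 1 by near: t; exact: powR_near0.
have : t `^ beta <= s / 2 / (`|d| + 1) by near: t; exact: powR_near0.
rewrite ler_pdivlMr ?ltr_wpDl // => yd.
rewrite dE (ger0_norm (powR_ge0 _ _)) (powR_natM t 4) (powR_natM t 2).
apply: sqrt_sum_sqr_expansion; rewrite ?y0 //; apply: le_trans yd.
rewrite [leRHS]mulrC -/d (le_trans (ler_norm _)) // normrM.
rewrite (ger0_norm (exprn_ge0 2 y0)) ler_pM ?exprn_ge0 //; first by rewrite lerDl.
by rewrite expr2 ler_piMr.
Unshelve. all: by end_near. Qed.

Lemma phase_expansion (T : R) (phi : R -> R) :
  0 < T -> series_converge_on beta T -> is_phase beta T phi ->
  phi = (fun t => t `^ beta / G1) +O_ (0^'+) (fun t => t `^ (3 * beta)).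
Proof.
move=> T0 cvT [cphi phi0 tanphi _].
have [M M0 HM] := Ec_Es_expansion T0 cvT.
set a := s / (9 * G2) in HM; set b := s / (3 * G1) in HM.
have bs : b / s = (3 * G1)^-1 by rewrite /b; field; rewrite !gt_eqF.
pose K := (s * M + `|b| * (`|a| + M)) / (s ^+ 2 / 2).
(* Below this threshold $y = t^\beta \le 1$ satisfies $(|a| + M) y \le s/2$, which forces [Ec] to be
   at least [s / 2]. *)
have e0 : 0 < s / 2 / (`|a| + M + 1) by rewrite !divr_gt0 // ltr_wpDl ?addr_ge0.
(* Continuity and [phi 0 = 0] confine [phi t / 3] to the principal branch, where [atan] inverts
   [tan]. Right continuity at 0 is read off on the closed interval up to [T / 2]. *)
have phi_small : \forall t \near 0^'+, `|phi t / 3| < pi / 2.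
  have : phi x @[x --> 0^'+] --> phi 0.
    have T2 : 0 < T / 2 by rewrite divr_gt0.
    have /(continuous_within_itvP _ T2)[] // : {within `[0, T / 2], continuous phi}.
    apply: continuous_subspaceW cphi => x /=; rewrite !in_itv /= => /andP[-> /= xT].
    by apply: le_lt_trans xT _; lra.
  have p0 : 0 < 3 * (pi / 2) :> R by rewrite mulr_gt0 // divr_gt0 // pi_gt0.
  rewrite phi0 => /cvgr0Pnorm_lt /(_ _ p0); apply: filterS => t.
  by rewrite normrM normfV (ger0_norm (_ : 0 <= 3)) // ltr_pdivrMr // mulrC.
apply: (@eqaddO_at_right _ _ (3 * ((`|b / s| + K) ^+ 3 + K))).
move: HM; apply: filter_app; near=> t => -[HEc HEs].
have t0 : 0 < t by near: t; exact: nbhs_right_gt.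
have tT : t < T by near: t; exact: nbhs_right_lt.
have y0 : 0 <= t `^ beta by exact: powR_ge0.
have y1 : t `^ beta <= 1 by near: t; exact: powR_near0.
have : t `^ beta <= s / 2 / (`|a| + M + 1) by near: t; exact: powR_near0.
rewrite ler_pdivlMr ?ltr_wpDl ?addr_ge0 // => ya.
have phit : `|phi t / 3| < pi / 2 by near: t; exact: phi_small.
rewrite (ger0_norm (powR_ge0 _ _)) (powR_natM t 3).
move: HEc HEs y0 y1 ya; set y := t `^ beta => HEc HEs y0 y1 ya.
have y2 : y ^+ 2 <= y by rewrite expr2 ler_piMr.
have y4 : y ^+ 4 <= y by rewrite (exprS y 3%N) ler_piMr // exprn_ile1.
have Ec2 : s / 2 <= Ec beta t.
  have h1 : a * y ^+ 2 <= `|a| * y.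
    by rewrite (le_trans (ler_wpM2r (exprn_ge0 2 y0) (ler_norm a))) // ler_wpM2l.
  have h2 : M * y ^+ 4 <= M * y by rewrite ler_wpM2l.
  move: HEc; rewrite ler_norml => /andP[+ _]; lra.
have Ec0 : Ec beta t != 0.
  by rewrite gt_eqF // (lt_le_trans _ Ec2) // divr_gt0.
have tE : phi t / 3 = atan (Es beta t / Ec beta t).
  rewrite -tanphi ?ltW ?tT //; first by rewrite tanK // in_itv /= -ltr_norml.
set w := Es beta t / Ec beta t in tE.
have hw : `|w - b / s * y| <= K * y ^+ 3.
  by apply: (quotient_expansion (a := a)) => //; rewrite y0.
have K0 : 0 <= K.
  by rewrite divr_ge0 ?divr_ge0 ?sqr_ge0 // addr_ge0 // mulr_ge0 ?addr_ge0.
have wy : `|w| <= (`|b / s| + K) * y.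
  have -> : w = b / s * y + (w - b / s * y) by ring.
  apply: (le_trans (ler_normD _ _)); rewrite (mulrDl `|b / s|) lerD //.
    by rewrite normrM (ger0_norm y0).
  rewrite (le_trans hw) // ler_wpM2l // (exprSr y 2%N) ler_piMl //.
  by rewrite exprn_ile1.
(* As $b/s = 1/(3\Gamma(1+\beta))$, the error splits into that of linearising [atan] and that of the
   quotient, both of order $y^3$. *)
have -> : phi t - y / G1 = 3 * ((atan w - w) + (w - b / s * y)).
  by rewrite bs -tE; field; rewrite gt_eqF.
rewrite normrM (ger0_norm (_ : 0 <= 3)) // -[leRHS]mulrA ler_wpM2l //.
apply: (le_trans (ler_normD _ _)); rewrite (mulrDl (_ ^+ 3)) lerD //.
rewrite (le_trans (norm_atanBid_le _)) // -exprMn lerXn2r ?nnegrE //.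
by rewrite mulr_ge0 // addr_ge0.
Unshelve. all: by end_near. Qed.

End expansions.

Unset Implicit Arguments.
Set Strict Implicit.

Theorem proposition5p2 (R : realType) :
  (forall (beta T : R) (phi : R -> R),
     0 < beta < 1 -> 0 < T ->
     series_converge_on beta T ->
     is_phase beta T phi ->
     A beta = (fun t => Num.sqrt (3 / 2)
                  - 1 / (3 * Num.sqrt 6) * gamma_gap beta * t `^ (2 * beta))
              +O_ (0^'+) (fun t => t `^ (4 * beta))
     /\
     phi = (fun t => t `^ beta / Gamma (1 + beta))
           +O_ (0^'+) (fun t => t `^ (3 * beta)))
  /\
  (forall beta : R, 0 < beta <= 1 ->
     0 <= gamma_gap beta /\ (gamma_gap beta = 0 <-> beta = 1)).
Proof.
split; last exact: gamma_gap_ge0_eq0.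
move=> beta T phi hbeta T0 cvT isphi; split.
- exact: (amplitude_expansion hbeta T0 cvT).
- exact: (phase_expansion hbeta T0 cvT isphi).
Qed.
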